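(* Let $G$ be a CDC graph. Then the clique-dual $G^c$ is also a CDC graph. Furthermore, $G^{cc}=G$, where $G^{cc}=(G^c)^c$.
   Context: All graphs are finite, simple, undirected, with nonempty vertex set. A clique is a set of pairwise adjacent vertices; it is maximal if it is not contained in a larger clique. A clique transversal of a graph is a set of vertices containing at least one vertex from each maximal clique; it is minimal if it contains no smaller clique transversal. The clique-dual of a graph $G$ is the graph $G^c$ with vertex set $V(G)$ in which two distinct vertices are adjacent if and only if they belong to a common minimal clique transversal of $G$. A hypergraph is a pair $(V,E)$ with $V$ a finite set and $E$ a set of subsets of $V$ (hyperedges) such that every vertex belongs to a hyperedge; it is conformal if every set of vertices such that any two of them belong to a common hyperedge is itself contained in a hyperedge. A graph $G$ is clique dually conformal (CDC) if the hypergraph with vertex set $V(G)$ whose hyperedges are the minimal clique transversals of $G$ is conformal. Equality of graphs means equality of vertex sets and edge sets (not just isomorphism). *)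

(* Defs.v *)
From HB Require Import structures.
From mathcomp Require Import all_boot.

Set Implicit Arguments.
Unset Strict Implicit.
Unset Printing Implicit Defensive.

(* A graph with vertex set T is given by its edge set, a set of 2-subsets of T.
   The proof field is boolean, so Leibniz equality of graphs over T is equality
   of edge sets; nonemptiness of T is left to the statements. *)
Record sgraph (T : finType) := SGraph {
  edges :> {set {set T}};
  _ : edges \subset [set e : {set T} | #|e| == 2]
}.

HB.instance Definition _ (T : finType) := [isSub for @edges T].

Definition adj (T : finType) (G : sgraph T) : rel T :=
  fun x y => [set x; y] \in edges G.

Definition clique (T : finType) (G : sgraph T) (K : {set T}) : bool :=
  [forall x in K, forall y in K, (x != y) ==> adj G x y].

Definition maximal_clique (T : finType) (G : sgraph T) (K : {set T}) : bool :=
  maxset (clique G) K.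

Definition clique_transversal (T : finType) (G : sgraph T) (S : {set T}) : bool :=
  [forall (K : {set T} | maximal_clique G K), S :&: K != set0].

Definition minimal_clique_transversal (T : finType) (G : sgraph T)
    (S : {set T}) : bool :=
  minset (clique_transversal G) S.

Definition clique_dual_edges (T : finType) (G : sgraph T) : {set {set T}} :=
  [set e : {set T} | (#|e| == 2) &&
    [exists (S : {set T} | minimal_clique_transversal G S), e \subset S]].

Lemma clique_dual_edges_card (T : finType) (G : sgraph T) :
  clique_dual_edges G \subset [set e : {set T} | #|e| == 2].
Proof. by apply/subsetP => e; rewrite !inE => /andP[]. Qed.

Definition clique_dual (T : finType) (G : sgraph T) : sgraph T :=
  SGraph (clique_dual_edges_card G).

Lemma adj_clique_dual (T : finType) (G : sgraph T) (x y : T) :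
  adj (clique_dual G) x y =
  (x != y) && [exists (S : {set T} | minimal_clique_transversal G S),
                 (x \in S) && (y \in S)].
Proof.
rewrite /adj inE cards2 eqSS eqb1; congr (_ && _).
by apply: eq_existsb => S; rewrite subUset !sub1set.
Qed.

Record hypergraph (T : finType) := Hypergraph {
  hyperedges :> {set {set T}};
  _ : cover hyperedges = [set: T]
}.

Definition conformal (T : finType) (H : hypergraph T) : Prop :=
  forall A : {set T},
    (forall x y : T, x \in A -> y \in A -> x != y ->
       exists2 E : {set T}, E \in hyperedges H & (x \in E) && (y \in E)) ->
    exists2 E : {set T}, E \in hyperedges H & A \subset E.

Definition minimal_clique_transversals (T : finType) (G : sgraph T) :
    {set {set T}} :=
  [set S : {set T} | minimal_clique_transversal G S].

Lemma cover_minimal_clique_transversals (T : finType) (G : sgraph T) :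
  cover (minimal_clique_transversals G) = [set: T].
Proof.
apply/setP => v; rewrite inE; apply/bigcupP.
have clq_v : clique G [set v].
  apply/forall_inP => x /set1P ->; apply/forall_inP => y /set1P ->.
  by rewrite eqxx.
have [K maxK] := maxset_exists clq_v; rewrite sub1set => vK.
have trU : clique_transversal G (v |: ~: K).
  apply/forall_inP => K' maxK'; apply/set0Pn.
  have [sK'K|] := boolP (K' \subset K).
    have <- : K = K' by apply: (maxsetsup maxK' _ sK'K); apply: maxsetp maxK.
    by exists v; rewrite !inE eqxx.
  by case/subsetPn => x xK' xNK; exists x; rewrite !inE xK' xNK orbT.
have [S minS sSU] := minset_exists trU; exists S; first by rewrite inE.
have /forall_inP/(_ K maxK)/set0Pn[x /setIP[xS xK]] := minsetp minS.
by have := subsetP sSU x xS; rewrite !inE xK orbF => /eqP <-.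
Qed.

Definition transversal_hypergraph (T : finType) (G : sgraph T) : hypergraph T :=
  Hypergraph (cover_minimal_clique_transversals G).

Definition CDC (T : finType) (G : sgraph T) : Prop :=
  conformal (transversal_hypergraph G).

(* Main.v *)
Require Import Defs.
From mathcomp Require Import all_boot.

(** The theorem is an instance of Berge duality.  Minimal transversals form an
    antichain, so when the hypergraph they span is conformal its hyperedges are
    exactly the maximal cliques of its co-occurrence graph: for a CDC graph G,
    the maximal cliques of the clique-dual are the minimal clique transversals
    of G ([maximal_clique_dual]).  The minimal clique transversals of the
    clique-dual are then obtained from the antichain of maximal cliques of G by
    taking minimal transversals twice, and this operation is an involution on
    antichains ([minset_transversalK]), so they are the maximal cliques of G
    ([minimal_clique_transversal_dual]).

    Both claims can now be read off.  Two vertices are adjacent in the double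
    clique-dual iff some maximal clique of G contains both, that is, iff they
    are adjacent in G; and the transversal hypergraph of the clique-dual is the
    hypergraph of maximal cliques of a graph, which is always conformal. *)

Definition antichain {T : finType} (H : pred {set T}) : Prop :=
  forall A B, H A -> H B -> A \subset B -> A = B.

Definition transversal {T : finType} (H : pred {set T}) : pred {set T} :=
  fun S => [forall (A | H A), S :&: A != set0].

Lemma antichain_minset {T : finType} (P : pred {set T}) :
  antichain (minset P).
Proof. by move=> A B minA minB; apply: (minsetinf minB); apply: minsetp minA. Qed.

Lemma antichain_maxset {T : finType} (P : pred {set T}) :
  antichain (maxset P).
Proof.
by move=> A B maxA maxB sAB; apply/esym/(maxsetsup maxA _ sAB); apply: maxsetp maxB.
Qed.

Lemma minset_supersets {T : finType} (H : pred {set T}) : antichain H ->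
  minset (fun S => [exists (A | H A), A \subset S]) =1 H.
Proof.
move=> acH S; apply/idP/idP => [minS|HS].
  have /exists_inP[A HA sAS] := minsetp minS.
  suff <- : A = S by [].
  by apply: (minsetinf minS) => //; apply/exists_inP; exists A.
apply/minsetP; split=> [|B /exists_inP[A HA sAB] sBS].
  by apply/exists_inP; exists S.
have eAS := acH _ _ HA HS (subset_trans sAB sBS).
by apply/eqP; rewrite eqEsubset sBS -eAS.
Qed.

Lemma maxset_subsets {T : finType} (H : pred {set T}) : antichain H ->
  maxset (fun S => [exists (A | H A), S \subset A]) =1 H.
Proof.
move=> acH S; apply/idP/idP => [maxS|HS].
  have /exists_inP[A HA sSA] := maxsetp maxS.
  suff <- : A = S by [].
  by apply: (maxsetsup maxS) => //; apply/exists_inP; exists A.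
apply/maxsetP; split=> [|B /exists_inP[A HA sBA] sSB].
  by apply/exists_inP; exists S.
have eSA := acH _ _ HS HA (subset_trans sSB sBA).
by apply/eqP; rewrite eqEsubset sSB andbT eSA.
Qed.

(** If S contains no member of H, then its complement meets every member of H,
    hence contains a minimal transversal, which S misses. *)
Lemma transversal_minset_transversal {T : finType} (H : pred {set T}) :
  transversal (minset (transversal H)) =1
  (fun S => [exists (A | H A), A \subset S]).
Proof.
move=> S; apply/idP/exists_inP => [/forall_inP trS|[A HA sAS]].
  apply/exists_inP; apply: contraT; rewrite negb_exists_in => /forall_inP noA.
  have trC : transversal H (~: S).
    apply/forall_inP => A /noA /subsetPn[x xA xNS].
    by apply/set0Pn; exists x; rewrite !inE xNS.
  have [B minB sBC] := minset_exists trC.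
  have /set0Pn[x /setIP[xS /(subsetP sBC)]] := trS B minB.
  by rewrite inE xS.
apply/forall_inP => B /minsetp/forall_inP/(_ A HA)/set0Pn[x /setIP[xB xA]].
by apply/set0Pn; exists x; rewrite inE xB (subsetP sAS).
Qed.

(** The transversals of the minimal transversals are the supersets of members
    of H, and in an antichain no member is a proper superset of another. *)
Lemma minset_transversalK {T : finType} (H : pred {set T}) : antichain H ->
  minset (transversal (minset (transversal H))) =1 H.
Proof.
move=> acH S; rewrite (minset_eq S (transversal_minset_transversal H)).
exact: minset_supersets.
Qed.

Lemma cliqueP {T : finType} (G : sgraph T) (K : {set T}) :
  reflect (forall x y, x \in K -> y \in K -> x != y -> adj G x y) (clique G K).
Proof.
apply: (iffP forall_inP) => [clK x y xK yK|adjK x xK].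
  by move/forall_inP/(_ y yK)/implyP: (clK x xK).
by apply/forall_inP => y yK; apply/implyP; apply: adjK.
Qed.

Lemma adj_neq {T : finType} (G : sgraph T) (x y : T) : adj G x y -> x != y.
Proof.
by move/(subsetP (valP G)); rewrite inE cards2 eqSS eqb1.
Qed.

Lemma sgraph_adj_inj {T : finType} (G1 G2 : sgraph T) :
  adj G1 =2 adj G2 -> G1 = G2.
Proof.
move=> eqG; apply: val_inj; apply/setP => e.
have [/cards2P[x [y [_ ->]]]|ncard] := boolP (#|e| == 2); first exact: eqG.
have notin (G : sgraph T) : (e \in val G) = false.
  by apply: contraNF ncard => /(subsetP (valP G)); rewrite inE.
by rewrite !notin.
Qed.

(** A graph is recovered from its maximal cliques because each edge is a clique,
    and so extends to a maximal one.  The right-hand side has the shape of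
    [adj_clique_dual], so that the two edge sets can be compared through the
    families that induce them. *)
Lemma adj_maximal_clique {T : finType} (G : sgraph T) (x y : T) :
  adj G x y = (x != y) && [exists (K : {set T} | maximal_clique G K),
                             (x \in K) && (y \in K)].
Proof.
apply/idP/andP => [adjxy|[neq_xy /exists_inP[K maxK /andP[xK yK]]]]; last first.
  by have /cliqueP := maxsetp maxK; apply.
split; first exact: adj_neq adjxy.
have clxy : clique G [set x; y].
  apply/cliqueP => u v /set2P[]-> /set2P[]->; rewrite ?eqxx //.
  by rewrite /adj setUC.
have [K maxK] := maxset_exists clxy; rewrite subUset !sub1set => sK.
by apply/exists_inP; exists K.
Qed.

(** Conformality is the implication from left to right: pairwise co-occurrence
    in minimal clique transversals is witnessed by a single one. *)
Lemma clique_dual_clique {T : finType} (G : sgraph T) : CDC G ->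
  clique (clique_dual G) =1
  (fun K => [exists (S | minimal_clique_transversal G S), K \subset S]).
Proof.
move=> cdcG K; apply/cliqueP/exists_inP => [adjK|[S minS sKS] x y xK yK neq_xy].
  have [|S] := cdcG K; last by rewrite inE; exists S.
  move=> x y xK yK /(adjK x y xK yK); rewrite adj_clique_dual.
  by case/andP=> _ /exists_inP[S minS xyS]; exists S; rewrite ?inE.
rewrite adj_clique_dual neq_xy; apply/exists_inP; exists S => //.
by rewrite !(subsetP sKS).
Qed.

Lemma maximal_clique_dual {T : finType} (G : sgraph T) : CDC G ->
  maximal_clique (clique_dual G) =1 minimal_clique_transversal G.
Proof.
move=> cdcG S; rewrite /maximal_clique (maxset_eq S (clique_dual_clique _ cdcG)).
by apply: maxset_subsets; apply: antichain_minset.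
Qed.

Lemma minimal_clique_transversal_dual {T : finType} (G : sgraph T) : CDC G ->
  minimal_clique_transversal (clique_dual G) =1 maximal_clique G.
Proof.
move=> cdcG S.
rewrite -[RHS](minset_transversalK _ (antichain_maxset (clique G))).
apply: minset_eq => {}S; apply: eq_forallb => A.
by rewrite maximal_clique_dual.
Qed.

Theorem proposition3p2 (T : finType) (T_nonempty : 0 < #|T|) (G : sgraph T)
    (G_CDC : CDC G) :
  CDC (clique_dual G) /\ clique_dual (clique_dual G) = G.
Proof.
have dualE := minimal_clique_transversal_dual _ G_CDC.
split=> [A coA|]; last first.
  apply: sgraph_adj_inj => x y; rewrite adj_clique_dual adj_maximal_clique.
  by congr (_ && _); apply: eq_existsb => K; rewrite dualE.
have clA : clique G A.
  apply/cliqueP => x y xA yA neq_xy; have [K] := coA x y xA yA neq_xy.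
  rewrite inE dualE adj_maximal_clique neq_xy => maxK xyK.
  by apply/exists_inP; exists K.
by have [K maxK sAK] := maxset_exists clA; exists K; rewrite ?inE ?dualE.
Qed.
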